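(* Let $n \ge 2$ be an integer and let $G = P_n \Box P_2$. Then $$S_{SC}(G) = \left(\{1\} \cup \left\{ 2j : j \in \mathbb{Z},\ \left\lfloor \tfrac{n}{2} \right\rfloor \le j \le n-1 \right\}\right) \setminus \{2\}.$$
   Context: $P_n$ denotes the path on $n$ vertices and $G\Box H$ the cartesian product of graphs. An orientation $D$ of a graph is strong if for every ordered pair of vertices $u,v$ there is a directed path from $u$ to $v$. A $uv$-geodesic in $D$ is a shortest directed path from $u$ to $v$. A nonempty set $S\subseteq V(D)$ is convex in $D$ if for every $u,v\in S$, every vertex lying on a $uv$-geodesic or on a $vu$-geodesic belongs to $S$. The convexity number $\mathrm{con}(D)$ is the maximum cardinality of a convex set of $D$ different from $V(D)$. The strong convexity spectrum of a graph $G$ is $S_{SC}(G)=\{\mathrm{con}(D) : D \text{ is a strong orientation of } G\}$. *)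

(* Defs.v *)
From mathcomp Require Import all_boot.
From mathcomp Require Import boolp classical_sets.

Set Implicit Arguments.
Unset Strict Implicit.
Unset Printing Implicit Defensive.

Record sgraph := SGraph {
  vertex :> finType;
  adj : rel vertex;
  adj_sym : symmetric adj;
  adj_irr : irreflexive adj
}.

Section Path.
Variable n : nat.

Definition path_adj : rel 'I_n :=
  fun i j => (i.+1 == j :> nat) || (j.+1 == i :> nat).

Fact path_adj_sym : symmetric path_adj.
Proof. by move=> i j; rewrite /path_adj orbC. Qed.

Fact path_adj_irr : irreflexive path_adj.
Proof. by move=> i; rewrite /path_adj orbb gtn_eqF. Qed.

Definition path_graph : sgraph := SGraph path_adj_sym path_adj_irr.

End Path.

Section CartesianProduct.
Variables G H : sgraph.

Definition cart_adj : rel (G * H)%type :=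
  fun x y => ((x.1 == y.1) && adj x.2 y.2) || (adj x.1 y.1 && (x.2 == y.2)).

Fact cart_adj_sym : symmetric cart_adj.
Proof.
move=> x y; rewrite /cart_adj (adj_sym x.1) (adj_sym x.2).
by rewrite (eq_sym x.1) (eq_sym x.2).
Qed.

Fact cart_adj_irr : irreflexive cart_adj.
Proof. by move=> x; rewrite /cart_adj !adj_irr andbF. Qed.

Definition cart_prod : sgraph := SGraph cart_adj_sym cart_adj_irr.

End CartesianProduct.

Notation "G □ H" := (cart_prod G H) (at level 40, left associativity).

(* A digraph on T is its arc relation D : rel T. *)
Section Digraph.
Variables (T : finType) (D : rel T).

(* The vertex sequence of the directed path is u :: p, hence its length (its
   number of arcs) is size p. *)
Definition dipath (u v : T) (p : seq T) : Prop :=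
  [/\ path D u p, last u p = v & uniq (u :: p)].

Definition strong : Prop := forall u v : T, exists p : seq T, dipath u v p.

Definition geodesic (u v : T) (p : seq T) : Prop :=
  dipath u v p /\ forall q : seq T, dipath u v q -> size p <= size q.

Definition on_geodesic (u v w : T) : Prop :=
  exists2 p : seq T, geodesic u v p & w \in u :: p.

Definition convex (S : {set T}) : Prop :=
  S <> finset.set0 /\
  forall u v w : T, u \in S -> v \in S ->
    on_geodesic u v w \/ on_geodesic v u w -> w \in S.

(* Singletons are convex, so the maximum is over a nonempty family as soon as
   1 < #|T|; the default value 0 is only met when #|T| <= 1. *)
Definition con : nat :=
  \max_(S : {set T} | `[< convex S >] && (S != finset.setT)) #|S|.

End Digraph.

Definition orientation (G : sgraph) (D : rel G) : Prop :=
  (forall u v : G, D u v -> adj u v) /\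
  (forall u v : G, adj u v -> D u v (+) D v u).

Definition strong_orientation (G : sgraph) (D : rel G) : Prop :=
  orientation D /\ strong D.

Definition strong_convexity_spectrum (G : sgraph) : set nat :=
  [set con D | D in [set D : rel G | strong_orientation D]]%classic.

(* Main.v *)
Require Import Defs.
From mathcomp Require Import all_boot.
From mathcomp Require Import zify.
From mathcomp Require Import boolp classical_sets.

Set Implicit Arguments.
Unset Strict Implicit.
Unset Printing Implicit Defensive.

(* In a strong orientation the two edges between consecutive columns are opposite
   arcs, so a convex set with at least two elements, being strongly connected, is
   a set of at least two consecutive full columns: con is 1 or even and at least 4.
   A set of columns bounded by a cut is entered and left through one arc each, so it
   is convex as soon as no geodesic from its exit to its entrance leaves it; it is not
   convex when the square across the cut is a directed 4-cycle. If no convex set of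
   at least floor(n/2) columns exists, then the squares next to the middle are directed
   cycles, and a comparison of detours of lengths 3 and 5 propagates this to all
   squares, whence con = 1.
   Conversely, an orientation with all squares directed has con = 1; destroying one
   square gives 2j for 2j >= n; destroying two adjacent squares gives n - 1 for n odd,
   because both detours around their common column then have length 5 as well. *)

(** * Geodesics and convex sets in digraphs *)

Section Geodesics.
Variables (T : finType) (D : rel T).
Implicit Types (S X : {set T}) (u v w : T) (p q : seq T).

Lemma walk_dipath u v p : path D u p -> last u p = v ->
  exists2 q, dipath D u v q & size q <= size p.
Proof.
move=> up <-; case/shortenP: up => q uq qU sub.
by exists q => //; apply: uniq_leq_size => //; case/andP: qU.
Qed.

Lemma geodesic_min u v p q :
  geodesic D u v p -> path D u q -> last u q = v -> size p <= size q.
Proof.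
move=> [_ min] uq qv; have [q' /min pq'] := walk_dipath uq qv.
exact: leq_trans.
Qed.

(** A shortest walk repeats no vertex: its shortening visits only vertices of [u :: p] and cannot be
    shorter. Geodesics may therefore be tested against arbitrary walks. *)
Lemma walk_geodesic u v p : path D u p -> last u p = v ->
  (forall q, path D u q -> last u q = v -> size p <= size q) ->
  geodesic D u v p.
Proof.
move=> up pv min; split; last by move=> q [uq qv _]; apply: min.
split=> //; have [q [uq qv qU] le_qp] : exists2 q, dipath D u v q & {subset q <= p}.
  move: pv; case/shortenP: (up) => q uq qU sub qv.
  by exists q => //; apply: sub.
apply: (leq_size_uniq qU); last by rewrite ltnS min.
by move=> z; rewrite !inE => /orP[->//|/le_qp ->]; exact: orbT.
Qed.

Lemma geodesic_exists u v : strong D -> exists p, geodesic D u v p.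
Proof.
move=> sD; have exn : exists k, `[< exists p, dipath D u v p /\ size p = k >].
  by have [p up] := sD u v; exists (size p); apply/asboolP; exists p.
case: (ex_minnP exn) => k /asboolP[p [up pk]] min; exists p; split=> // q uq.
by rewrite pk; apply: min; apply/asboolP; exists q.
Qed.

Lemma path_exit S u p : path D u p -> u \in S -> last u p \notin S ->
  exists p1 z p2, [/\ p = p1 ++ z :: p2, last u p1 \in S & z \notin S].
Proof.
elim: p u => [|z p IH] u /=; first by move=> _ ->.
move=> /andP[_ zp] uS pS; have [zS|zS] := boolP (z \in S); last first.
  by exists [::], z, p.
by have [p1 [t [p2 [-> h1 h2]]]] := IH _ zp zS pS; exists (z :: p1), t, p2.
Qed.

Lemma convex_walk S u v : strong D -> convex D S -> u \in S -> v \in S ->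
  exists p, [/\ path D u p, last u p = v & forall w, w \in p -> w \in S].
Proof.
move=> sD [_ cS] uS vS; have [p gp] := geodesic_exists u v sD.
exists p; case: (gp) => -[? ? _] _; split=> // w wp.
by apply: cS uS vS _; left; exists p => //; rewrite inE wp orbT.
Qed.

(** A geodesic between two members of [S] stays in [S], so [S] induces a strongly connected
    subdigraph and every cut separating two members is crossed inside [S]. *)
Lemma convex_exit S X u v : strong D -> convex D S -> u \in S -> v \in S ->
  u \in X -> v \notin X ->
  exists x y, [/\ x \in S, y \in S, x \in X, y \notin X & D x y].
Proof.
move=> sD cS uS vS uX vX; have [p [up pv pS]] := convex_walk sD cS uS vS.
have [] := path_exit up uX; first by rewrite pv.
move=> p1 [z [p2 [ep p1X zX]]]; exists (last u p1), z.
move: up pS; rewrite ep cat_path /= => /and3P[_ Dz _] pS; split=> //.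
  have := mem_last u p1; rewrite inE => /orP[/eqP->//|h].
  by apply: pS; rewrite mem_cat h.
by apply: pS; rewrite mem_cat inE eqxx orbT.
Qed.

Lemma convex1 u : convex D [set u].
Proof.
split; first by move/setP/(_ u); rewrite !inE eqxx.
move=> x y w /finset.set1P -> /finset.set1P ->.
suff H : on_geodesic D u u w -> w \in [set u] by case.
by case=> p gp; have := @geodesic_min u u p [::] gp isT erefl; case: p {gp} => [|? ?] /=;
  rewrite ?ltn0 ?inE.
Qed.

Lemma leq_con S : convex D S -> S != finset.setT -> #|S| <= con D.
Proof.
move=> cS ST; rewrite /con.
by apply: (@leq_bigmax_cond _ _ (fun S : {set T} => #|S|)); rewrite ST andbT; apply/asboolP.
Qed.

Lemma con_leq k : (forall S, convex D S -> S != finset.setT -> #|S| <= k) ->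
  con D <= k.
Proof. by move=> h; apply/bigmax_leqP => S /andP[/asboolP cS ST]; apply: h. Qed.

Lemma con_attained : 1 < #|T| ->
  exists S, [/\ convex D S, S != finset.setT & con D = #|S|].
Proof.
move=> T1; have /card_gt0P[u _] : 0 < #|T| by apply: ltnW.
have [|S /andP[/asboolP cS ST] e] := @eq_bigmax_cond _
  (fun S : {set T} => `[< convex D S >] && (S != finset.setT)) (fun S => #|S|).
  apply/card_gt0P; exists [set u]; apply/andP; split.
    by apply/asboolP; apply: convex1.
  apply: contraTneq T1 => /(congr1 (fun A : {set T} => #|A|)).
  by rewrite cards1 cardsT => <-.
by exists S; split=> //; rewrite /con -e; apply: eq_bigl.
Qed.

(** * Sets left and entered through a single arc *)

Section Gate.
Variables (S : {set T}) (e e' f' f : T).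
Hypotheses (eS : e \in S) (fS : f \in S).
Hypothesis out_gate : forall u v, u \in S -> v \notin S -> D u v -> u = e /\ v = e'.
Hypothesis in_gate : forall u v, u \notin S -> v \in S -> D u v -> u = f' /\ v = f.

(** The path is cut at its first exit from [S] and at its first return to [S] after [w]. *)
Lemma detour u v w p : path D u p -> last u p = v -> u \in S -> v \in S ->
    w \in p -> w \notin S ->
  exists a q c, [/\ p = a ++ e' :: q ++ f :: c, last u a = e,
                    last e' q = f' & w \in e' :: q].
Proof.
move=> up pv uS vS wp wS; move: up pv.
case/path.splitP: wp => p1 p2; rewrite cat_path last_cat last_rcons.
move=> /andP[up1 wp2] p2v.
have [|a [z [a2 [ea aS zS]]]] := path_exit up1 uS; first by rewrite last_rcons.
have [||c1 [y [c [ec]]]] := @path_exit (~: S) _ _ wp2; rewrite ?inE // ?p2v ?vS //.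
rewrite negbK => c1S yS.
move: up1; rewrite ea cat_path /= => /and3P[_ Dz _].
move: wp2; rewrite ec cat_path /= => /and3P[_ Dy _].
have [ea1 ez] := out_gate aS zS Dz; have [ef ey] := in_gate c1S yS Dy.
have ew : last e' a2 = w.
  by have := congr1 (last w) ea; rewrite last_rcons last_cat /= ez.
exists a, (a2 ++ c1), c; split=> //.
- by rewrite ez ey -!catA.
- by rewrite last_cat ew.
- by rewrite -ew -cat_cons mem_cat mem_last.
Qed.

(** If a geodesic between members of [S] left [S], its piece from [e] to [f] would itself be a
    geodesic leaving [S], since a shorter piece could replace it. Only geodesics from [e] to [f]
    need testing. *)
Lemma gate_convex : (forall w, on_geodesic D e f w -> w \in S) -> convex D S.
Proof.
move=> stay; split; first by move/setP/(_ e); rewrite eS inE.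
suff H u v w : u \in S -> v \in S -> on_geodesic D u v w -> w \in S.
  by move=> u v w uS vS [] ; apply: H.
move=> uS vS [p gp]; rewrite inE => /orP[/eqP->//|wp].
apply: contraT => wS; case: (gp) => -[up pv _] _.
have [a [q [c [ep ae qf wq]]]] := detour up pv uS vS wp wS.
move: (up) (pv); rewrite ep cat_path last_cat ae /= cat_path last_cat qf /=.
move=> /and5P[ua Dee' e'q Df'f fc] cv.
case/negP: wS; apply: stay; exists (e' :: rcons q f); last first.
  by rewrite -rcons_cons in_cons mem_rcons in_cons wq !orbT.
apply: walk_geodesic; rewrite /= ?rcons_path ?qf ?last_rcons ?Dee' ?e'q //.
move=> t et tf; have := @geodesic_min u v p (a ++ t ++ c) gp.
rewrite !cat_path !last_cat ae tf et ua fc cv => /(_ isT erefl).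
by rewrite ep !size_cat /= size_rcons !size_cat /=; clear; lia.
Qed.

Lemma gate_arc_convex : D e f -> convex D S.
Proof.
move=> Def; apply: gate_convex => w [p gp].
have p1 : size p <= 1 by apply: (@geodesic_min e f p [:: f]); rewrite //= Def.
have {gp} [[_ pf _] _] := gp.
case: p p1 pf => [|x [|//]] _ /=; first by move=> _; rewrite inE => /eqP->.
by move->; rewrite !inE => /orP[] /eqP->.
Qed.

(** A walk from [e] to [f] leaving [S] needs at least two arcs from [e'] to [f'] besides the exit
    and entrance arcs, so it has length at least 4 and loses against [p]. *)
Lemma gate_detour_convex p : path D e p -> last e p = f -> size p <= 3 ->
  e' != f' -> ~~ D e' f' -> convex D S.
Proof.
move=> ep pf p3 nef nD; apply: gate_convex => w [g gg].
have g3 := leq_trans (geodesic_min gg ep pf) p3.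
rewrite inE => /orP[/eqP->//|wg]; apply: contraT => wS; case: (gg) => -[eg gf _] _.
have [a [q [c [E ae qf _]]]] := detour eg gf eS fS wg wS.
move: eg; rewrite E cat_path ae /= => /and3P[_ _]; rewrite cat_path => /andP[e'q _].
move: g3 qf e'q; rewrite E size_cat /= size_cat /=.
case: q {E} => [|x [|y q]] /=; last by clear; lia.
  by move=> _ /eqP; rewrite (negPf nef).
by move=> _ ->; rewrite (negPf nD).
Qed.

End Gate.
End Geodesics.

Lemma strong_exit (T : finType) (D : rel T) (X : {set T}) u v :
    strong D -> u \in X -> v \notin X ->
  exists x y, [/\ x \in X, y \notin X & D x y].
Proof.
move=> sD uX vX; have [p [up pv _]] := sD u v.
have [|p1 [z [p2 [ep p1X zX]]]] := path_exit up uX; first by rewrite pv.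
by exists (last u p1), z; move: up; rewrite ep cat_path /= => /and3P[_ -> _].
Qed.

(** * Strong orientations of the ladder *)

Section Ladder.
Variable m : nat.
Notation T := ('I_m.+1 * 'I_2)%type.
Notation V := (path_graph m.+1 □ path_graph 2).
Implicit Types (u v w : T) (S : {set T}) (k i : nat) (x y : bool).

Definition col u : nat := u.1.
Definition row u : bool := u.2 == 1 :> nat.
(** Coordinates are plain numbers and booleans, to allow column arithmetic; [inord] collapses
    columns above [m], whence the recurring bounds [k <= m]. *)
Definition pt k x : T := (inord k, inord x).

Lemma col_pt k x : k <= m -> col (pt k x) = k.
Proof. by move=> km; rewrite /col inordK. Qed.

Lemma row_pt k x : row (pt k x) = x.
Proof. by rewrite /row inordK //; case: x. Qed.

Lemma ptK u : pt (col u) (row u) = u.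
Proof.
case: u => i j; rewrite /pt /col /row /= inord_val; congr pair.
by apply: val_inj; rewrite /= inordK; case: j => [[|[|]]].
Qed.

Lemma col_leq u : col u <= m.
Proof. exact: leq_ord. Qed.

Lemma ladder_adjE u v : @adj V u v =
  (col u == col v) && (row u != row v) ||
  (row u == row v) && ((col v == (col u).+1) || (col u == (col v).+1)).
Proof.
case: u v => [i j] [i' j']; rewrite /adj /= /cart_adj /= /path_adj /col /row /=.
rewrite -!(inj_eq val_inj) /= [_ == i' :> nat in RHS](eq_sym).
case: j j' => [[|[|//]] ?] [[|[|//]] ?] /=; rewrite ?andbT ?andbF ?orbF //= ?[_.+1 == _]eq_sym //.
Qed.

(* By strength, the two edges between columns k and k+1 go in opposite
   directions: [s k] is the row of the one going right. [r k] is the row from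
   which the edge inside column k starts. *)
Definition ladder (s r : nat -> bool) : rel T := fun u v =>
  [|| [&& col u == col v, row u != row v & row u == r (col u)],
      [&& row u == row v, col v == (col u).+1 & row u == s (col u)]
    | [&& row u == row v, col u == (col v).+1 & row u != s (col v)]].

Variant ladder_edge_spec : T -> T -> Prop :=
| LadderRung k x of k <= m : ladder_edge_spec (pt k x) (pt k (~~ x))
| LadderRight k x of k < m : ladder_edge_spec (pt k x) (pt k.+1 x)
| LadderLeft k x of k < m : ladder_edge_spec (pt k.+1 x) (pt k x).

Lemma ladder_edgeP u v : @adj V u v -> ladder_edge_spec u v.
Proof.
have um := col_leq u; have vm := col_leq v.
move=> uv; rewrite -(ptK u) -(ptK v); move: uv; rewrite ladder_adjE.
case/orP => [/andP[/eqP <- uv]|/andP[/eqP <- /orP[] /eqP e]].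
- suff -> : row v = ~~ row u by apply: LadderRung.
  by move: uv; case: (row u) (row v) => [] [].
- by rewrite e in vm *; apply: LadderRight.
- by rewrite e in um *; apply: LadderLeft.
Qed.

Section Arcs.
Variables s r : nat -> bool.

Let E1 a : (a == a.+1) = false. Proof. by rewrite ltn_eqF. Qed.
Let E2 a : (a.+1 == a) = false. Proof. by rewrite gtn_eqF. Qed.
Let E3 a : (a == a.+2) = false. Proof. by rewrite ltn_eqF. Qed.

Lemma ladder_rung k x : k <= m -> ladder s r (pt k x) (pt k (~~ x)) = (x == r k).
Proof.
by move=> km; rewrite /ladder !row_pt !col_pt // eqxx !E1; case: x; case: (r k).
Qed.

Lemma ladder_rungN k x : k <= m -> ladder s r (pt k (~~ x)) (pt k x) = (x != r k).
Proof.
by move=> km; have := ladder_rung (~~ x) km; rewrite negbK => ->; case: x (r k) => [] [].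
Qed.

Lemma ladder_right k x : k < m -> ladder s r (pt k x) (pt k.+1 x) = (x == s k).
Proof.
move=> km; rewrite /ladder !row_pt !col_pt ?(ltnW km) // !eqxx !(E1, E2, E3) /=.
by rewrite orbF.
Qed.

Lemma ladder_left k x : k < m -> ladder s r (pt k.+1 x) (pt k x) = (x != s k).
Proof.
by move=> km; rewrite /ladder !row_pt !col_pt ?(ltnW km) // !eqxx !(E1, E2, E3).
Qed.

Lemma ladder_adj u v : ladder s r u v -> @adj V u v.
Proof.
by rewrite ladder_adjE /ladder => /or3P[] /and3P[-> -> _]; rewrite ?orbT.
Qed.

Lemma ladder_orientation : @orientation V (ladder s r).
Proof.
split=> [u v|u v /ladder_edgeP[] k x km]; first exact: ladder_adj.
- by rewrite ladder_rungN // ladder_rung //; case: (x == _).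
- by rewrite ladder_right // ladder_left //; case: (x == _).
- by rewrite ladder_right // ladder_left //; case: (x == _).
Qed.

End Arcs.

Lemma ladder_of_strong (D : rel T) : @strong_orientation V D ->
  exists s r, D = ladder s r.
Proof.
move=> [[Dadj Dor] sD].
have Dbi u v : @adj V u v -> D u v = ~~ D v u.
  by move/Dor; case: (D u v) (D v u) => [] [].
have adjh k x : k < m -> @adj V (pt k x) (pt k.+1 x).
  by move=> km; rewrite ladder_adjE !row_pt !col_pt ?(ltnW km) // !eqxx orbT.
have adjv k : k <= m -> @adj V (pt k false) (pt k true).
  by move=> km; rewrite ladder_adjE !row_pt !col_pt // eqxx.
have cut k : k < m -> D (pt k false) (pt k.+1 false) = ~~ D (pt k true) (pt k.+1 true).
  move=> km; have km' := ltnW km.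
  (* The boolean [x] selects the side of the cut to leave: columns up to [k] for [false], the
     columns beyond for [true]. Strength thus yields one arc in each direction. *)
  have crossing x : exists y, D (pt k y) (pt k.+1 y) != x.
    have [||u [v]] := @strong_exit _ D [set u | (col u <= k) (+) x]
        (pt (if x then k.+1 else k) true) (pt (if x then k else k.+1) true) sD.
    - by rewrite inE; case: x; rewrite col_pt ?ltnn ?leqnn.
    - by rewrite inE; case: x; rewrite col_pt ?ltnn ?leqnn.
    rewrite !inE => -[+ + Duv]; have Huv := Dadj _ _ Duv.
    case/ladder_edgeP: Huv Duv => l y lm.
    - by rewrite !col_pt // => _ ->.
    - rewrite !col_pt ?(ltnW lm) //; case: x => Dl h1 h2; first by lia.
      have -> : k = l by lia.
      by exists y; rewrite Dl.
    - rewrite !col_pt ?(ltnW lm) //; case: x => Dl h1 h2; last by lia.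
      have -> : k = l by lia.
      by exists y; rewrite Dbi ?adjh // Dl.
  move: (crossing true) (crossing false) => [y +] [z].
  by case: y z => [] []; case: (D (pt k true) _) (D (pt k false) _) => [] [].
exists (fun k => D (pt k true) (pt k.+1 true)), (fun k => D (pt k true) (pt k false)).
apply: funext => u; apply: funext => v.
have [|nuv] := boolP (@adj V u v); last first.
  transitivity false; first by apply: contraNF nuv; apply: Dadj.
  by apply/esym; apply: contraNF nuv; apply: ladder_adj.
have right k x : k < m ->
    D (pt k x) (pt k.+1 x) = (x == D (pt k true) (pt k.+1 true)).
  by move=> km; case: x; rewrite ?cut //; case: (D _ _).
case/ladder_edgeP => k x km.
- rewrite ladder_rung //; case: x => /=; first by case: (D _ _).
  by rewrite Dbi ?adjv //; case: (D _ _).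
- by rewrite ladder_right // right.
- by rewrite ladder_left // -right // Dbi ?adjh // adj_sym adjh.
Qed.

Section Orientation.
Variables s r : nat -> bool.
Notation D := (ladder s r).

(* The edge inside column i is consistent with a directed 4-cycle on columns i-1
   and i (left), resp. i and i+1 (right). *)
Definition closes_left i := (0 < i) && (r i == s i.-1).
Definition closes_right i := (i < m) && (r i != s i).

Definition strip a b : {set T} := [set u | a <= col u <= b].

Lemma pt_in_strip a b k x : k <= m -> (pt k x \in strip a b) = (a <= k <= b).
Proof. by move=> km; rewrite inE col_pt. Qed.

Lemma card_strip a b : a <= b <= m -> #|strip a b| = 2 * (b.+1 - a).
Proof.
move=> /andP[ab bm].
have -> : strip a b = finset.setX [set i : 'I_m.+1 | a <= i <= b] finset.setT.
  by apply/setP => -[i j]; rewrite !inE andbT.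
rewrite cardsX cardsT card_ord mulnC; congr (2 * _).
rewrite -sum1dep_card -[RHS]muln1 -sum_nat_const_nat big_geq_mkord.
by rewrite (big_ord_widen_cond m.+1 (fun i => a <= i) (fun=> 1)) //=.
Qed.

Lemma strip_proper a b : a <= b <= m -> (strip a b != finset.setT) = (0 < a) || (b < m).
Proof.
move=> abm; have cT : #|finset.setT : {set T}| = 2 * m.+1.
  by rewrite cardsT card_prod !card_ord mulnC.
apply/idP/idP => [|ab].
  apply: contraNT; rewrite negb_or -!leqNgt leqn0 => /andP[/eqP -> mb].
  by apply/eqP/setP => u; rewrite !inE (leq_trans (col_leq u)).
apply/eqP => /(congr1 (fun A : {set T} => #|A|)); rewrite card_strip // cT.
by move: abm ab; clear; lia.
Qed.

Lemma cross_right k u v : D u v -> col u <= k -> k < col v ->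
  u = pt k (s k) /\ v = pt k.+1 (s k).
Proof.
move=> Duv; have Huv := ladder_adj Duv; case/ladder_edgeP: Huv Duv => l x lm.
- by rewrite !col_pt // => _; lia.
- rewrite ladder_right // !col_pt ?(ltnW lm) // => /eqP ->; clear => h1 h2.
  by have -> : k = l by lia.
- by rewrite !col_pt ?(ltnW lm) // => _; clear; lia.
Qed.

Lemma cross_left k u v : D u v -> k < col u -> col v <= k ->
  u = pt k.+1 (~~ s k) /\ v = pt k (~~ s k).
Proof.
move=> Duv; have Huv := ladder_adj Duv; case/ladder_edgeP: Huv Duv => l x lm.
- by rewrite !col_pt // => _; lia.
- by rewrite !col_pt ?(ltnW lm) // => _; clear; lia.
- rewrite ladder_left // !col_pt ?(ltnW lm) // => xs h1 h2.
  have -> : k = l by clear -h1 h2; lia.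
  by have -> : x = ~~ s l by case: x (s l) xs => [] [].
Qed.

Lemma closes_strong : 0 < m ->
  (forall i, i <= m -> closes_left i || closes_right i) -> strong D.
Proof.
move=> m0 ok.
(* One can turn back after entering column [k.+1] from the left: either its rung serves, or that
   rung closes the square on its right, [s k = s k.+1], and the turn is made further right.
   [left_turn] is the mirror image. *)
have right_turn k : k < m -> connect D (pt k.+1 (s k)) (pt k.+1 (~~ s k)).
  move=> km; have [d] := ubnP (m - k); elim: d k km => // d IH k km dk.
  have /orP[/andP[_ /eqP /= e]|/andP[km' rs]] := ok k.+1 km.
    by apply: connect1; rewrite ladder_rung // e.
  have [e|e] := eqVneq (s k) (r k.+1).
    by apply: connect1; rewrite ladder_rung // e.
  have {}e : s k = s k.+1 by case: (s k) (s k.+1) (r k.+1) e rs => [] [] [].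
  rewrite e; apply: (@connect_trans _ _ (pt k.+2 (s k.+1))).
    by apply: connect1; rewrite ladder_right.
  apply: (connect_trans (IH k.+1 km' _)); first by clear -dk km; lia.
  by apply: connect1; rewrite ladder_left //; case: (s _).
have left_turn k : k < m -> connect D (pt k (~~ s k)) (pt k (s k)).
  elim: k => [|k IH] km.
    have /andP[_ rs] := ok 0 isT; apply: connect1.
    by rewrite ladder_rungN // eq_sym.
  have [e|e] := eqVneq (r k.+1) (~~ s k.+1).
    by apply: connect1; rewrite ladder_rungN ?e ?(ltnW km) //; case: (s _).
  have /orP[/andP[_ /eqP /= e']|/andP[_ rs]] := ok k.+1 (ltnW km); last first.
    by case: (r _) (s _) e rs => [] [].
  have {e'}e : s k.+1 = s k.
    by rewrite -e'; case: (r _) (s _) e => [] [].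
  rewrite e; apply: (@connect_trans _ _ (pt k (~~ s k))).
    by apply: connect1; rewrite ladder_left ?(ltnW km) //; case: (s _).
  apply: (connect_trans (IH (ltnW km))).
  by apply: connect1; rewrite ladder_right ?(ltnW km).
(* The two arcs between the columns and the two turns form a closed walk through all four
   corners. *)
have square k x y : k < m ->
    connect D (pt k x) (pt k.+1 y) /\ connect D (pt k.+1 y) (pt k x).
  move=> km.
  have e1 : connect D (pt k (s k)) (pt k.+1 (s k)).
    by apply: connect1; rewrite ladder_right.
  have e2 : connect D (pt k.+1 (~~ s k)) (pt k (~~ s k)).
    by apply: connect1; rewrite ladder_left //; case: (s k).
  have lt := left_turn k km; have rt := right_turn k km.
  have ce3 := connect_trans (connect_trans e1 rt) e2.
  have ce4 := connect_trans (connect_trans e2 lt) e1.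
  have [-> ->] : x = (if x == s k then s k else ~~ s k)
      /\ y = (if y == s k then s k else ~~ s k).
    by case: x y (s k) => [] [] [].
  case: (x == s k); case: (y == s k); split=> //.
  - exact: connect_trans rt (connect_trans e2 lt).
  - exact: connect_trans e1 rt.
  - exact: connect_trans e2 lt.
  - exact: connect_trans lt e1.
  - exact: connect_trans rt e2.
  - exact: connect_trans lt (connect_trans e1 rt).
have hub k x : k <= m ->
    connect D (pt 0 true) (pt k x) /\ connect D (pt k x) (pt 0 true).
  elim: k x => [|k IH] x km.
    have [[h1 h2] [h3 h4]] := (square 0 x true m0, square 0 true true m0).
    by split; [apply: connect_trans h3 h2 | apply: connect_trans h1 h4].
  have [h1 h2] := square k true x km; have [h3 h4] := IH true (ltnW km).
  by split; [apply: connect_trans h3 h1 | apply: connect_trans h2 h4].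
move=> u v; have [_ h1] := hub (col u) (row u) (col_leq u).
have [h2 _] := hub (col v) (row v) (col_leq v).
have := connect_trans h1 h2; rewrite !ptK => /connectP[p up pv].
by have [q] := walk_dipath up (esym pv); exists q.
Qed.

(** * Convex sets of the ladder *)

Lemma convex_strip S : strong D -> convex D S -> 1 < #|S| ->
  exists a b, [/\ a < b, b <= m & S = strip a b].
Proof.
move=> sD cS /card_gt1P[u0 [u1 [u0S u1S u01]]].
case: (arg_minnP col u0S) => ua uaS umin.
case: (arg_maxnP col u0S) => ub ubS umax.
(* The cut after column [k] is crossed inside [S] in both directions; the two arcs lie in different
   rows, so their ends fill both columns. *)
have cut k x : col ua <= k < col ub -> pt k x \in S /\ pt k.+1 x \in S.
  move=> /andP[ak kb].
  have [||v [w [vS wS]]] := @convex_exit _ D S [set u | col u <= k] ua ub sD cS uaS ubS.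
  - by rewrite inE.
  - by rewrite inE -ltnNge.
  rewrite !inE -ltnNge => vk kw Dvw.
  have [ev ew] := cross_right Dvw vk kw.
  have [||v' [w' [v'S w'S]]] := @convex_exit _ D S [set u | k < col u] ub ua sD cS ubS uaS.
  - by rewrite inE.
  - by rewrite inE -leqNgt.
  rewrite !inE -leqNgt => v'k kw' Dvw'.
  have [ev' ew'] := cross_left Dvw' v'k kw'.
  have -> : x = (if x == s k then s k else ~~ s k) by case: x (s k) => [] [].
  by case: (x == s k); rewrite -?ev -?ew -?ev' -?ew'.
(* Within a single column, each of two members of [S] would have to be the tail of the rung, which
   has only one. *)
have ab : col ua < col ub.
  rewrite ltnNge; apply/negP => ba.
  have cE u : u \in S -> col u = col ua.
    move=> uS; apply/eqP; rewrite eqn_leq umin // andbT.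
    exact: leq_trans (umax _ uS) ba.
  have rE u v : u \in S -> v \in S -> u != v -> row v = ~~ row u.
    move=> uS vS; apply: contraNeq => e; rewrite -(ptK u) -(ptK v) !cE //.
    by apply/eqP; congr pt; case: (row u) (row v) e => [] [].
  have H u v : u \in S -> v \in S -> u != v -> row u = r (col ua).
    move=> uS vS uv; have [||y [z [yS zS]]] := @convex_exit _ D S [set u] u v sD cS uS vS.
    - by rewrite inE.
    - by rewrite inE eq_sym.
    rewrite !inE => /eqP-> zu; rewrite -(ptK u) -(ptK z) (rE u z) // 1?eq_sym //.
    by rewrite !cE // ladder_rung ?col_leq // row_pt => /eqP.
  have := rE _ _ u0S u1S u01.
  by rewrite (H _ _ u0S u1S) // (H _ _ u1S u0S) 1?eq_sym //; case: (r _).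
exists (col ua), (col ub); split=> //; last first.
- apply/setP => u; rewrite inE; apply/idP/idP => [uS|/andP[au]].
    by apply/andP; split; [apply: umin | apply: umax].
  rewrite leq_eqVlt => /orP[/eqP ub'|ub']; last first.
    by have [] := cut (col u) (row u); rewrite ?au ?ptK.
  have [] := cut (col u).-1 (row u); first by rewrite ub'; clear -ab; lia.
  by rewrite prednK ?ptK // ub'; clear -ab; lia.
- exact: col_leq.
Qed.

Lemma gate_right k : k < m ->
  [/\ pt k (s k) \in strip 0 k, pt k (~~ s k) \in strip 0 k,
   forall u v, u \in strip 0 k -> v \notin strip 0 k -> D u v ->
     u = pt k (s k) /\ v = pt k.+1 (s k) &
   forall u v, u \notin strip 0 k -> v \in strip 0 k -> D u v ->
     u = pt k.+1 (~~ s k) /\ v = pt k (~~ s k)].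
Proof.
move=> km; rewrite !inE !col_pt ?(ltnW km) // leqnn; split=> // u v.
  by rewrite !inE /= -ltnNge => uk vk Duv; apply: cross_right.
by rewrite !inE /= -ltnNge => uk vk Duv; apply: cross_left.
Qed.

Lemma gate_left k : k < m ->
  [/\ pt k.+1 (~~ s k) \in strip k.+1 m, pt k.+1 (s k) \in strip k.+1 m,
   forall u v, u \in strip k.+1 m -> v \notin strip k.+1 m -> D u v ->
     u = pt k.+1 (~~ s k) /\ v = pt k (~~ s k) &
   forall u v, u \notin strip k.+1 m -> v \in strip k.+1 m -> D u v ->
     u = pt k (s k) /\ v = pt k.+1 (s k)].
Proof.
move=> km; rewrite !inE !col_pt // leqnn km; split=> // u v.
  by rewrite !inE !col_leq !andbT -leqNgt => uk vk Duv; apply: cross_left.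
by rewrite !inE !col_leq !andbT -leqNgt => uk vk Duv; apply: cross_right.
Qed.

(** A rung not closing the square on its right is an arc from the exit of the strip to its
    entrance. *)
Lemma strip_right_convex k : k < m -> ~~ closes_right k -> convex D (strip 0 k).
Proof.
move=> km; rewrite /closes_right km negbK => /eqP e.
have [h1 h2 h3 h4] := gate_right km.
by apply: (gate_arc_convex h1 h2 h3 h4); rewrite ladder_rung ?e // ltnW.
Qed.

Lemma strip_left_convex k : k < m -> ~~ closes_left k.+1 -> convex D (strip k.+1 m).
Proof.
move=> km; rewrite /closes_left /= => e.
have [h1 h2 h3 h4] := gate_left km.
apply: (gate_arc_convex h1 h2 h3 h4).
by rewrite ladder_rungN // eq_sym.
Qed.

(** If rung [k.+1] also closes the square on its right, the other three sides of the directed square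
    on columns [k] and [k.+1] lead from exit to entrance inside the strip, while rung [k.+2] has the
    wrong direction for a return of length 3 outside. *)
Lemma strip_right_detour k : k.+1 < m -> closes_right k -> closes_left k.+1 ->
  ~~ closes_left k.+2 -> convex D (strip 0 k.+1).
Proof.
move=> km Rk Lk; have [|/(strip_right_convex km)//] := boolP (closes_right k.+1).
move: Rk Lk; rewrite /closes_right /closes_left /= km => /andP[km' rk] lk rk' lk'.
have [h1 h2 h3 h4] := gate_right km.
apply: (gate_detour_convex h1 h2 h3 h4
  (p := [:: pt k (s k.+1); pt k (~~ s k.+1); pt k.+1 (~~ s k.+1)])) => //=.
- rewrite ladder_left // ladder_rung ?(ltnW km') // ladder_right //.
  by move: rk lk rk'; case: (r k) (s k) (r k.+1) (s k.+1) => [] [] [] [].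
- by apply/eqP => /(congr1 row); rewrite !row_pt; case: (s _).
- by rewrite ladder_rung // eq_sym.
Qed.

Lemma strip_left_detour k : k.+1 < m -> closes_right k.+1 -> closes_left k.+2 ->
  ~~ closes_right k -> convex D (strip k.+1 m).
Proof.
move=> km Rk Lk; have km' := ltnW km.
have [|/(strip_left_convex km')//] := boolP (closes_left k.+1).
move: Rk Lk; rewrite /closes_right /closes_left /= km km' negbK /= => rk lk lk' rk'.
have [h1 h2 h3 h4] := gate_left km'.
apply: (gate_detour_convex h1 h2 h3 h4
  (p := [:: pt k.+2 (~~ s k); pt k.+2 (s k); pt k.+1 (s k)])) => //=.
- rewrite ladder_right // ladder_rungN // ladder_left //.
  by move: rk lk lk'; case: (r k.+2) (s k) (r k.+1) (s k.+1) => [] [] [] [].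
- by apply/eqP => /(congr1 row); rewrite !row_pt; case: (s _).
- by rewrite ladder_rungN ?(ltnW km') // negbK eq_sym.
Qed.

(** * Distances between the ends of a rung, and geodesics leaving a strip *)

Lemma walk_potential (f : T -> nat) u p :
  (forall v w, D v w -> f w <= (f v).+1) -> path D u p ->
  f (last u p) <= f u + size p.
Proof.
move=> Df; elim: p u => [|v p IH] u /=; first by rewrite addn0.
by move=> /andP[/Df uv /IH]; rewrite addnS -addSn => /leq_trans; apply; rewrite leq_add2r.
Qed.

(* The potential of (k, x) is min(d, |k - c|), and that of (k, ~~ x) is
   2d + 1 - min(d, |k - c|). *)
Lemma rung_distance d c x p :
  c <= m -> (forall k, k <= m -> (k - c) + (c - k) < d -> r k = ~~ x) ->
  path D (pt c x) p -> last (pt c x) p = pt c (~~ x) -> 2 * d < size p.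
Proof.
move=> cm rc wp pl.
pose t u := minn d ((col u - c) + (c - col u)).
pose f u := if row u == x then t u else (2 * d).+1 - t u.
have := @walk_potential f (pt c x) p _ wp.
rewrite pl /f /t !row_pt !col_pt // eqxx subnn minn0 subn0.
have -> : (~~ x == x) = false by case: x {rc f wp pl}.
rewrite add0n; apply=> u v Duv.
have Huv := ladder_adj Duv; case/ladder_edgeP: Huv Duv => l y lm.
- rewrite ladder_rung // !row_pt !col_pt // => /eqP e.
  have [ey|yx] := eqVneq y x; last first.
    by rewrite (_ : ~~ y == x); [clear; lia | case: (y) (x) yx => [] []].
  have -> : (~~ y == x) = false by rewrite ey; case: (x).
  (* At distance less than [d] from column [c] no rung leaves row [x]; from distance [d] on, such a
     rung raises the potential only from [d] to [d + 1]. *)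
  have [h|] := ltnP ((l - c) + (c - l)) d; last by clear; lia.
  by have := rc l lm h; rewrite -e ey; case: (x).
- rewrite !row_pt !col_pt ?(ltnW lm) // => _; case: eqP => _; clear; lia.
- rewrite !row_pt !col_pt ?(ltnW lm) // => _; case: eqP => _; clear; lia.
Qed.

(** A walk of length at most [2 * d + 1] meets the lower bound of [rung_distance], so it is a
    geodesic. *)
Lemma convex_contains_walk S d c x p :
    convex D S -> pt c x \in S -> pt c (~~ x) \in S ->
    c <= m -> (forall k, k <= m -> (k - c) + (c - k) < d -> r k = ~~ x) ->
    path D (pt c x) p -> last (pt c x) p = pt c (~~ x) -> size p <= (2 * d).+1 ->
  {in p, forall w, w \in S}.
Proof.
move=> [_ cS] cxS cxS' cm rc Dp pl sp w wp.
apply: cS cxS cxS' _; left; exists p; last by rewrite inE wp orbT.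
apply: walk_geodesic => // q Dq ql; apply: leq_trans sp _.
exact: rung_distance cm rc Dq ql.
Qed.

(** Against the direction of rung [k], the other three sides of the directed square form a geodesic:
    this is the case [d = 1]. *)
Lemma square_leaves_right S k : k < m -> closes_right k -> closes_left k.+1 ->
  convex D S -> (forall x, pt k x \in S) -> pt k.+1 (s k) \in S.
Proof.
rewrite /closes_right /closes_left => km; rewrite km /= => rk /eqP lk cS kS.
pose p := [:: pt k.+1 (s k); pt k.+1 (~~ s k); pt k (~~ s k)].
apply: (convex_contains_walk (d := 1) (c := k) (x := s k) (p := p)) => //.
- exact: ltnW.
- move=> i im h; have -> : i = k by clear -h; lia.
  by case: (r k) (s k) rk => [] [].
- by rewrite /= ladder_right // ladder_rung // ladder_left // lk eqxx; case: (s k).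
- by rewrite inE eqxx.
Qed.

Lemma square_leaves_left S k : k < m -> closes_right k -> closes_left k.+1 ->
  convex D S -> (forall x, pt k.+1 x \in S) -> pt k (~~ s k) \in S.
Proof.
rewrite /closes_right /closes_left => km; rewrite km /= => rk /eqP lk cS kS.
pose p := [:: pt k (~~ s k); pt k (s k); pt k.+1 (s k)].
apply: (convex_contains_walk (d := 1) (c := k.+1) (x := ~~ s k) (p := p)) => //.
- move=> i im h; have -> : i = k.+1 by clear -h; lia.
  by rewrite negbK.
- rewrite /= ladder_left // ladder_right // ladder_rungN ?(ltnW km) //.
  by case: (r k) (s k) rk => [] [].
- by rewrite /= negbK.
- by rewrite inE eqxx.
Qed.

Lemma convex_strip_right a b : a <= b -> b < m -> convex D (strip a b) ->
  ~~ (closes_right b && closes_left b.+1).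
Proof.
move=> ab bm cS; apply/negP => /andP[Rb Lb].
have bS x : pt b x \in strip a b by rewrite pt_in_strip ?(ltnW bm) // ab leqnn.
by have := square_leaves_right bm Rb Lb cS bS; rewrite pt_in_strip // ltnn andbF.
Qed.

Lemma convex_strip_left a b : a < b -> b <= m -> convex D (strip a.+1 b) ->
  ~~ (closes_right a && closes_left a.+1).
Proof.
move=> ab bm cS; have am := leq_trans ab bm; apply/negP => /andP[Ra La].
have aS x : pt a.+1 x \in strip a.+1 b by rewrite pt_in_strip // leqnn.
by have := square_leaves_left am Ra La cS aS; rewrite pt_in_strip ?(ltnW am) // ltnn.
Qed.

(** * Bounds on the convexity number of a ladder orientation *)

Lemma con_gt0 : 0 < con D.
Proof.
have /leq_con : convex D [set pt 0 true] by apply: convex1.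
rewrite cards1; apply; apply/eqP => /setP/(_ (pt 0 false)).
by rewrite !inE => /eqP/(congr1 row); rewrite !row_pt.
Qed.

Lemma con_bound j : 0 < j -> strong D ->
  (forall a b, a < b -> b <= m -> (0 < a) || (b < m) -> convex D (strip a b) ->
    b.+1 - a <= j) ->
  con D <= 2 * j.
Proof.
move=> j0 sD h; apply: con_leq => S cS ST.
have [S1|/(convex_strip sD cS)[a [b [ab bm e]]]] := leqP #|S| 1.
  by apply: leq_trans S1 _; rewrite muln_gt0.
have abm : a <= b <= m by rewrite (ltnW ab).
move: cS ST; rewrite e card_strip // strip_proper // leq_mul2l /= => cS ST.
exact: h.
Qed.

(** A proper strip of at least two columns ends inside the ladder, where a geodesic escapes along
    the directed square across its border. *)
Lemma con_directed_squares : strong D ->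
  (forall k, k < m -> closes_right k && closes_left k.+1) -> con D = 1.
Proof.
move=> sD sq; apply/eqP; rewrite eqn_leq con_gt0 andbT.
apply: con_leq => S cS ST; rewrite leqNgt; apply/negP.
move=> /(convex_strip sD cS)[a [b [ab bm e]]]; move: cS ST; rewrite {}e => cS.
rewrite strip_proper ?(ltnW ab) // => /orP[|bm'].
  case: a ab cS => // a ab cS _.
  by have /negP := convex_strip_left (ltnW ab) bm cS; apply; apply: sq;
    apply: leq_trans (ltnW ab) bm.
by have /negP := convex_strip_right (ltnW ab) bm' cS; apply; apply: sq.
Qed.

Lemma leq_con_strip a b : a <= b <= m -> (0 < a) || (b < m) ->
  convex D (strip a b) -> 2 * (b.+1 - a) <= con D.
Proof.
by move=> abm pr cS; rewrite -card_strip // leq_con // strip_proper.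
Qed.

Lemma con_small_directed_squares : strong D -> con D < 2 * (m.+1 %/ 2) ->
  forall k, k < m -> closes_right k && closes_left k.+1.
Proof.
move=> sD; set h := m.+1 %/ 2; move=> small.
have h2 : 2 * h <= m.+1 <= (2 * h).+1 by rewrite /h; clear; lia.
have noR k : k < m -> h <= k.+1 -> ~ convex D (strip 0 k).
  move=> km hk /(@leq_con_strip 0 k (ltnW km) km).
  by move: hk small; clear; lia.
have noL k : k < m -> k + h <= m -> ~ convex D (strip k.+1 m).
  move=> km hk /(@leq_con_strip k.+1 m); rewrite km leqnn => /(_ isT isT).
  by move: hk small; clear; lia.
have Rbig k : k < m -> h <= k.+1 -> closes_right k.
  move=> km hk; apply: contraT => /(strip_right_convex km) c.
  by case: (noR k km hk).
have Lsmall k : k < m -> k + h <= m -> closes_left k.+1.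
  move=> km hk; apply: contraT => /(strip_left_convex km) c.
  by case: (noL k km hk).
(* Downward induction: if column [k] in the left half failed, columns [k.+1] to [m], at least [h] of
   them, would be convex by the detour comparison at the directed square on columns [k.+1] and
   [k.+2]. *)
have Rall k : k < m -> closes_right k.
  have [d] := ubnP (m - k); elim: d k => // d IH k dk km.
  have [hk|hk] := leqP h k.+1; first exact: Rbig.
  have km' : k.+1 < m by clear -hk h2; lia.
  apply: contraT => Rk; case: (noL k km); first by clear -hk h2; lia.
  apply: strip_left_detour => //; first by apply: IH => //; clear -dk km; lia.
  by apply: Lsmall => //; clear -hk h2; lia.
(* Upward induction, mirroring the previous one; [Rall] now supplies that the square on columns [k]
   and [k.+1] is directed. *)
have Lall k : k < m -> closes_left k.+1.
  elim: k => [|k IH] km; first by apply: Lsmall => //; clear -h2 km; lia.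
  have [hk|hk] := leqP (k.+1 + h) m; first exact: Lsmall.
  apply: contraT => Lk; case: (noR k.+1 km); first by clear -hk h2; lia.
  by apply: strip_right_detour => //; [apply: Rall; apply: ltnW | apply: IH; apply: ltnW].
by move=> k km; rewrite Rall ?Lall.
Qed.

Lemma strong_con : strong D -> con D != 1 ->
  exists j, [/\ con D = 2 * j, m.+1 %/ 2 <= j, j <= m & 1 < j].
Proof.
move=> sD c1; have [|S [cS ST e]] := @con_attained _ D.
  by rewrite card_prod !card_ord mulnC; case: m.
have S1 : 1 < #|S|.
  by move: c1 con_gt0; rewrite e; case: #|S| => [|[]].
have [a [b [ab bm eS]]] := convex_strip sD cS S1.
have abm : a <= b <= m by rewrite (ltnW ab).
move: ST e; rewrite eS strip_proper // card_strip // => ab' e.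
exists (b.+1 - a); split=> //.
- rewrite leqNgt; apply/negP => lt; case/eqP: c1.
  apply: con_directed_squares => //; apply: con_small_directed_squares => //.
  by rewrite e ltn_pmul2l.
- by clear -ab' abm; lia.
- by clear -ab; lia.
Qed.

End Orientation.

(** * Orientations realizing the spectrum *)

Section Pattern.
Variables b c : nat.

(* Every column closes the squares on both of its sides, except that column [b]
   does not close the one on its right and column [c] not the one on its left;
   values of [b] and [c] above [m] mean that there is no such exception. *)
Definition pattern_sign i := odd i (+) (b <= i < c).
Definition pattern_rung i := ~~ pattern_sign i (+) (i == b).
Definition pattern := ladder pattern_sign pattern_rung.

Hypotheses (b_gt0 : 0 < b) (le_bc : b <= c).

(** From [i] to [i.+1] the parity flips, and the indicator of [b <= i < c] changes at [b] and at
    [c]; the correction in [pattern_rung] cancels the change at [b]. *)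
Lemma pattern_closes_left i :
  closes_left pattern_sign pattern_rung i.+1 = (i.+1 != c).
Proof.
rewrite /closes_left /pattern_rung /pattern_sign /=.
have -> : (b <= i < c) = (b <= i.+1 < c) (+) ((i.+1 == b) (+) (i.+1 == c)).
  by move: le_bc; clear; lia.
by case: (odd i) (b <= _ < _) (i.+1 == b) (i.+1 == c) => [] [] [] [].
Qed.

Lemma pattern_closes_right i :
  closes_right pattern_sign pattern_rung i = (i < m) && (i != b).
Proof.
by rewrite /closes_right /pattern_rung; case: (i == b); case: (pattern_sign i).
Qed.

(** The bounds ensure that no column fails on both sides: column 0 differs from [b], column [m] from
    [c], and [b] and [c] do not coincide inside the ladder. *)
Lemma pattern_strong : 0 < m -> (b < c < m) || (m < c) -> strong pattern.
Proof.
move=> m0 cm; apply: closes_strong => // -[|i] im.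
  by rewrite pattern_closes_right m0 eq_sym -lt0n b_gt0 orbT.
rewrite pattern_closes_left pattern_closes_right.
by move: cm; clear -im; lia.
Qed.

Lemma pattern_strong_orientation : 0 < m -> (b < c < m) || (m < c) ->
  @strong_orientation V pattern.
Proof. by split; [apply: ladder_orientation | apply: pattern_strong]. Qed.

Lemma pattern_right_end a b' : a <= b' -> b' < m -> convex pattern (strip a b') ->
  (b' == b) || (b'.+1 == c).
Proof.
move=> ab bm /(convex_strip_right ab bm).
by rewrite pattern_closes_left pattern_closes_right bm /= negb_and !negbK.
Qed.

Lemma pattern_left_end a b' : a < b' -> b' <= m -> convex pattern (strip a.+1 b') ->
  (a == b) || (a.+1 == c).
Proof.
move=> ab bm /(convex_strip_left ab bm).
by rewrite pattern_closes_left pattern_closes_right (leq_trans ab bm) /= negb_and !negbK.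
Qed.

Lemma pattern_strip_convex : b < m -> convex pattern (strip 0 b).
Proof.
by move=> bm; apply: strip_right_convex; rewrite // pattern_closes_right eqxx andbF.
Qed.

End Pattern.

Lemma con_pattern1 : 0 < m -> con (pattern m.+1 m.+1) = 1.
Proof.
move=> m0; apply: con_directed_squares => [|k km].
  by apply: pattern_strong => //; rewrite leqnn orbT.
rewrite pattern_closes_right pattern_closes_left // km.
by move: km; clear; lia.
Qed.

(** A convex strip can only end between columns [b] and [b.+1]. The left part is convex, and
    [m.+1 <= 2 * b.+1] says that the right part is no larger. *)
Lemma con_pattern_large b : 0 < b < m -> m.+1 <= 2 * b.+1 ->
  con (pattern b m.+1) = 2 * b.+1.
Proof.
move=> /andP[b0 bm] mb; have bm' : b <= m.+1 by apply: leqW; apply: ltnW.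
apply/eqP; rewrite eqn_leq; apply/andP; split; last first.
  rewrite -[X in 2 * X <= _]subn0; apply: leq_con_strip; rewrite ?bm ?(ltnW bm) //.
  exact: pattern_strip_convex.
apply: con_bound => // [|a b' ab b'm].
  by apply: pattern_strong => //; [apply: leq_trans b0 (ltnW bm) | rewrite leqnn orbT].
have [b'm'|mb'] := ltnP b' m.
  move=> _ /(pattern_right_end bm' (ltnW ab) b'm') => h.
  by move: h; clear -b'm'; lia.
case: a ab => [//|a] ab.
move=> _ /(pattern_left_end bm' (ltnW ab) b'm) h.
by move: h mb b'm mb' ab; clear; lia.
Qed.

Lemma con_pattern_half j : m = 2 * j.+2 ->
  con (pattern j.+1 j.+3) = 2 * j.+2.
Proof.
move=> mj; set D := pattern _ _.
have jm4 : j.+4 <= m by rewrite mj; clear; lia.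
have jm3 := ltnW jm4; have jm2 := ltnW jm3; have jm1 := ltnW jm2; have jm0 := ltnW jm1.
pose s := pattern_sign j.+1 j.+3; pose r := pattern_rung j.+1 j.+3; pose o := odd j.
have [s0 s1 s2 s3] : [/\ s j = o, s j.+1 = o, s j.+2 = ~~ o & s j.+3 = ~~ o].
  by rewrite /s /pattern_sign /= !ltnS !leqnn !ltnn !leqnSn ?andbF /= -/o; case: o; split; lia.
have [r0 r1 r2 r3 r4] :
    [/\ r j = ~~ o, r j.+1 = o, r j.+2 = o, r j.+3 = o & r j.+4 = ~~ o].
  by rewrite /r /pattern_rung -/s s0 s1 s2 s3 /s /pattern_sign; split; lia.
have sD : strong D by apply: pattern_strong => //; move: jm4; clear; lia.
have le13 : j.+1 <= j.+3 by clear; lia.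
(* Rungs [j.+1] to [j.+3] all start in row [o], so returning from row [~~ o] to row [o] of the
   middle column [j.+2] takes 5 arcs. The detours through columns [j] and [j.+4] both attain this,
   so no convex strip ends at column [j.+2]. *)
have near k : k <= m -> (k - j.+2) + (j.+2 - k) < 2 -> r k = ~~ ~~ o.
  move=> _ h; have : [|| k == j.+1, k == j.+2 | k == j.+3] by move: h; clear; lia.
  by case/or3P => /eqP ->; rewrite negbK.
have right_leaves S : convex D S -> (forall x, pt j.+2 x \in S) -> pt j.+3 (~~ o) \in S.
  move=> cS jS; pose p := [:: pt j.+3 (~~ o); pt j.+4 (~~ o); pt j.+4 o; pt j.+3 o; pt j.+2 o].
  apply: (convex_contains_walk (d := 2) (c := j.+2) (x := ~~ o) (p := p) cS) => //.
  - rewrite /= ladder_right // ladder_right // ladder_rungN // ladder_left // ladder_left //.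
    by rewrite -/s -/r s2 s3 r4; case: (o).
  - by rewrite /= negbK.
  - by rewrite inE eqxx.
have left_leaves S : convex D S -> (forall x, pt j.+2 x \in S) -> pt j.+1 (~~ o) \in S.
  move=> cS jS; pose p := [:: pt j.+1 (~~ o); pt j (~~ o); pt j o; pt j.+1 o; pt j.+2 o].
  apply: (convex_contains_walk (d := 2) (c := j.+2) (x := ~~ o) (p := p) cS) => //.
  - rewrite /= ladder_left // ladder_left // ladder_rungN // ladder_right // ladder_right //.
    by rewrite -/s -/r s0 s1 r0; case: (o).
  - by rewrite /= negbK.
  - by rewrite inE eqxx.
apply/eqP; rewrite eqn_leq; apply/andP; split; last first.
  rewrite -[X in 2 * X <= _]subn0; apply: leq_con_strip; rewrite ?jm2 ?jm1 //.
  exact: pattern_strip_convex.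
apply: con_bound => // a b ab bm pr cS.
have right_end : b < m -> b = j.+1.
  move=> bm'; have := pattern_right_end le13 (ltnW ab) bm' cS.
  case/orP => /eqP // [eb]; move: ab bm cS; rewrite {}eb => ab bm cS.
  have jS x : pt j.+2 x \in strip a j.+2 by rewrite pt_in_strip // leqnn ltnW.
  by have := right_leaves _ cS jS; rewrite pt_in_strip // ltnn andbF.
have left_end : 0 < a -> a = j.+3.
  case: a ab pr cS right_end => // a ab _ cS _ _.
  have := pattern_left_end le13 (ltnW ab) bm cS.
  case/orP => /eqP ea; last exact: ea.
  move: ab cS; rewrite {}ea => ab cS.
  have jS x : pt j.+2 x \in strip j.+2 b by rewrite pt_in_strip // leqnn ltnW.
  by have := left_leaves _ cS jS; rewrite pt_in_strip // ltnn.
by move: pr right_end left_end mj ab bm; clear; lia.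
Qed.

End Ladder.

Local Open Scope classical_set_scope.

Theorem theorem10 (n : nat) (hn : 2 <= n) :
  strong_convexity_spectrum (path_graph n □ path_graph 2) =
  ([set 1] `|` [set 2 * j | j in [set j : nat | n %/ 2 <= j <= n - 1]])
    `\` [set 2].
Proof.
case: n hn => // m m0; rewrite ltnS in m0; apply/seteqP; split=> k /=.
  case=> D oD <-; have [s [r eD]] := ladder_of_strong oD.
  have sD : strong (ladder (m := m) s r) by rewrite -eD; case: oD.
  rewrite eD; have [->|/(strong_con sD)[j [-> hj jm j1]]] := eqVneq (con (ladder (m := m) s r)) 1.
    by split=> //; left.
  split; last by move=> /eqP; clear -j1; lia.
  by right; exists j => //=; rewrite hj subn1.
case=> -[->|[j /= /andP[hj jm] <-]] k2.
  exists (pattern (m := m) m.+1 m.+1).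
    by apply: pattern_strong_orientation; rewrite ?leqnn ?orbT.
  exact: con_pattern1.
(* For [2 * j >= n] the first [j] columns are made convex, whence [b = j.-1]; [b = 0] would give the
   excluded value 2. *)
have [hm|hm] := leqP m.+1 (2 * j).
  exists (pattern (m := m) j.-1 m.+1).
    apply: pattern_strong_orientation => //; rewrite ?leqnn ?orbT //.
      by move: k2 hm m0; clear; lia.
    by move: jm; clear; lia.
  case: j => [|j] in hj jm k2 hm *; first by move: hm; clear; lia.
  apply: con_pattern_large => //; case: j => [|j] in hj jm k2 hm *; first by case: k2.
  by move: jm; clear; lia.
(* What remains is [j] equal to the floor of [n / 2] with [n] odd, that is [m = 2 * j]; here too
   [j = 1] is the excluded value. *)
case: j => [|[|j]] in hj jm k2 hm *.
- by move: hj m0; clear; lia.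
- by case: k2.
have mj : m = 2 * j.+2 by move: hj hm; clear; lia.
exists (pattern (m := m) j.+1 j.+3).
  by apply: pattern_strong_orientation => //; move: mj; clear; lia.
exact: con_pattern_half.
Qed.
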